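(* Let $f:\mathbb{R}^n\to\mathbb{R}$ satisfy: (A1) $f$ is continuous and bounded; (A2) $f$ attains its minimum, i.e. with $\underline f:=\min_{z\in\mathbb{R}^n}f(z)$ the set of global minimizers $\mathfrak{M}:=\{x\in\mathbb{R}^n: f(x)=\underline f\}$ is nonempty; (A3) for every $\delta>0$ there exists $\gamma=\gamma(\delta)>0$ such that $\inf\{f(x)-\underline f:\operatorname{dist}(x,\mathfrak{M})>\delta\}>\gamma(\delta)$. Let $y_x^{\alpha_\varepsilon}(\cdot)$ be an $\varepsilon$-optimal trajectory, starting from $x$, for the finite-horizon un-discounted problem ($t<\infty$). Then, when $\varepsilon$ is small, the set of global minimizers $\mathfrak{M}$ is Lyapunov stable, i.e. $$\forall\,\delta>0,\ \exists\,\eta>0\ \text{such that}\ \operatorname{dist}(x,\mathfrak{M})\le\eta\ \Longrightarrow\ \operatorname{dist}\big(y_x^{\alpha_\varepsilon}(s),\mathfrak{M}\big)\le\delta\quad\forall\,s\in[0,t].$$ This is in particular satisfied by an optimal trajectory.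
   Context: $\|f\|_\infty=\sup|f|$. Fix a constant $M\ge1+\sqrt{6\|f\|_\infty}$ (which can be taken arbitrarily large) and let $B_M$ be the closed ball of radius $M$ centered at $0$ in $\mathbb{R}^n$. Admissible controls are measurable functions $\alpha(\cdot):[0,\infty)\to B_M$; the trajectory starting from $x\in\mathbb{R}^n$ with control $\alpha$ is $y_x^\alpha(s)=x+\int_0^s\alpha(r)\,dr$. The finite-horizon un-discounted problem, with horizon $t<\infty$, has value function $$u(x,t)=\inf_\alpha\int_0^t\Big(\tfrac12|\alpha(s)|^2+f(y_x^\alpha(s))\Big)\,ds.$$ For $\varepsilon>0$, a trajectory $y_x^{\alpha_\varepsilon}$ with admissible control $\alpha_\varepsilon$ is $\varepsilon$-optimal if $\int_0^t(\tfrac12|\alpha_\varepsilon(s)|^2+f(y_x^{\alpha_\varepsilon}(s)))\,ds\le u(x,t)+\varepsilon$; it is optimal if this holds with $\varepsilon=0$. $\operatorname{dist}(y,\mathfrak{M})=\inf_{z\in\mathfrak{M}}|y-z|$. *)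

(* Defs.v *)
From HB Require Import structures.
From mathcomp Require Import all_boot all_order all_algebra.
From mathcomp Require Import all_classical all_reals all_analysis.

Set Implicit Arguments.
Unset Strict Implicit.
Unset Printing Implicit Defensive.

Import Order.TTheory GRing.Theory Num.Theory.
Import numFieldNormedType.Exports.

Local Open Scope classical_set_scope.
Local Open Scope ring_scope.

(* The library norm on 'rV[R]_n is the sup norm, so the Euclidean one is
   defined here. Both induce the same topology: [continuous] and [open] on
   'rV[R]_n have their usual meaning. *)
Definition enorm (R : realType) (n : nat) (v : 'rV[R]_n) : R :=
  Num.sqrt (\sum_(i < n) v 0 i ^+ 2).

(* Only meaningful for nonempty A: the infimum of the empty set is 0. *)
Definition dist (R : realType) (n : nat) (x : 'rV[R]_n) (A : set 'rV[R]_n) : R :=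
  inf [set enorm (x - z) | z in A].

Definition supnorm (R : realType) (n : nat) (f : 'rV[R]_n -> R) : R :=
  sup (range (fun x => `|f x|)).

Definition fmin (R : realType) (n : nat) (f : 'rV[R]_n -> R) : R :=
  inf (range f).

(* For f bounded below, this set is nonempty exactly when f attains its
   minimum, in which case [fmin f] is that minimum. *)
Definition minimizers (R : realType) (n : nat) (f : 'rV[R]_n -> R) :
  set 'rV[R]_n := [set x | f x = fmin f].

(* The infimum is taken in the extended reals because no point need be at
   distance more than delta from the minimizers; it is then +oo. *)
Definition well_separated (R : realType) (n : nat) (f : 'rV[R]_n -> R) : Prop :=
  forall delta : R, 0 < delta -> exists2 gamma : R, 0 < gamma &
    (gamma%:E < ereal_inf [set (f x - fmin f)%:E |
                  x in [set x | (delta < dist x (minimizers f))%R]])%E.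

(* R with the sigma-algebra of Lebesgue measurable sets, the domain of
   [completed_lebesgue_measure] (on the bare type R, [measurable] means Borel). *)
Definition lebesgueTypeR (R : realType) :=
  caratheodory_type (mu_ext (wlength (@idfun R))).

HB.instance Definition _ (R : realType) := Measurable.on (lebesgueTypeR R).

Definition borelTypeRn (R : realType) (n : nat) :=
  g_sigma_algebraType (@open 'rV[R]_n).

HB.instance Definition _ (R : realType) (n : nat) :=
  Measurable.on (borelTypeRn R n).

(* Controls are total functions; only their values on [0, +oo[ matter. *)
Definition admissible (R : realType) (n : nat) (M : R) (alpha : R -> 'rV[R]_n) :
  Prop :=
  measurable_fun (`[0, +oo[ : set (lebesgueTypeR R))
    (alpha : lebesgueTypeR R -> borelTypeRn R n) /\
  forall s, 0 <= s -> enorm (alpha s) <= M.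

Definition trajectory (R : realType) (n : nat) (x : 'rV[R]_n)
    (alpha : R -> 'rV[R]_n) (s : R) : 'rV[R]_n :=
  \row_(i < n) (x 0 i +
    \int[@completed_lebesgue_measure R]_(r in `[0, s]) alpha r 0 i).

Definition cost (R : realType) (n : nat) (f : 'rV[R]_n -> R) (t : R)
    (x : 'rV[R]_n) (alpha : R -> 'rV[R]_n) : R :=
  \int[@completed_lebesgue_measure R]_(s in `[0, t])
    (2^-1 * enorm (alpha s) ^+ 2 + f (trajectory x alpha s)).

Definition value (R : realType) (n : nat) (f : 'rV[R]_n -> R) (M t : R)
    (x : 'rV[R]_n) : R :=
  inf [set cost f t x alpha | alpha in [set alpha | admissible M alpha]].

Definition eps_optimal (R : realType) (n : nat) (f : 'rV[R]_n -> R) (M t eps : R)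
    (x : 'rV[R]_n) (alpha : R -> 'rV[R]_n) : Prop :=
  admissible M alpha /\ cost f t x alpha <= value f M t x + eps.

Definition optimal (R : realType) (n : nat) (f : 'rV[R]_n -> R) (M t : R)
    (x : 'rV[R]_n) (alpha : R -> 'rV[R]_n) : Prop :=
  eps_optimal f M t 0 x alpha.

(* Main.v *)
Require Import Defs.
From HB Require Import structures.
From mathcomp Require Import all_boot all_order all_algebra.
From mathcomp Require Import all_classical all_reals all_analysis.
From mathcomp Require Import measurable_realfun ring lra.
Import Order.TTheory GRing.Theory Num.Theory.
Import numFieldNormedType.Exports.
Local Open Scope classical_set_scope.
Local Open Scope ring_scope.
Set Implicit Arguments.
Unset Strict Implicit.
Unset Printing Implicit Defensive.

(** The proof compares two bounds on the cost of a near-optimal trajectory, both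
    measured above the unavoidable amount [fmin f * t].

    From above: starting at distance at most [eta] from the set of minimizers,
    one may walk at unit speed to a minimizer and stop there. The walk takes time
    less than [2 eta] and exceeds the minimal running cost by a bounded amount,
    so the value exceeds [fmin f * t] by a multiple of [eta]
    ([value_le_minimizer]).

    From below: controls are bounded, so trajectories are Lipschitz with a common
    constant ([trajectory_lip]). A trajectory found at distance more than [delta]
    has therefore spent a time [h], which depends only on [delta], at distance
    more than [delta / 2]. There the separation hypothesis gives
    [fmin f + gamma <= f], so the cost exceeds [fmin f * t] by at least
    [gamma * h] ([cost_ge]).

    For [eta] and [eps] small the two bounds are incompatible
    ([eps_optimal_stable]), and an optimal trajectory is [eps]-optimal for every
    [eps]. The remaining work is to make the cost a genuine integral: its
    integrand is measurable and bounded because trajectories are continuous and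
    [f] is continuous and bounded ([cost_integrable]). *)

(** * The Euclidean norm and the distance to a set *)

Section EuclideanNorm.
Context {R : realType} {n : nat}.
Implicit Types (u v w x y z : 'rV[R]_n) (A : set 'rV[R]_n).

Lemma sumsqr_ge0 v : 0 <= \sum_(i < n) v 0 i ^+ 2.
Proof. by apply: sumr_ge0 => i _; exact: sqr_ge0. Qed.

Lemma enorm_ge0 v : 0 <= enorm v.
Proof. exact: sqrtr_ge0. Qed.

Lemma sqr_enorm v : enorm v ^+ 2 = \sum_(i < n) v 0 i ^+ 2.
Proof. by rewrite sqr_sqrtr// sumsqr_ge0. Qed.

Lemma enormN v : enorm (- v) = enorm v.
Proof. by congr Num.sqrt; apply: eq_bigr => i _; rewrite mxE sqrrN. Qed.

Lemma enormBC u v : enorm (u - v) = enorm (v - u).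
Proof. by rewrite -enormN opprB. Qed.

Lemma enormZ a v : enorm (a *: v) = `|a| * enorm v.
Proof.
rewrite -sqrtr_sqr -sqrtrM ?sqr_ge0// mulr_sumr.
by congr Num.sqrt; apply: eq_bigr => i _; rewrite mxE exprMn.
Qed.

Lemma enorm0 : enorm (0 : 'rV[R]_n) = 0.
Proof. by rewrite -(scale0r 0) enormZ normr0 mul0r. Qed.

Lemma ler_coord_enorm v i : `|v 0 i| <= enorm v.
Proof.
rewrite -sqrtr_sqr ler_wsqrtr// (bigD1 i)//= lerDl.
by apply: sumr_ge0 => j _; exact: sqr_ge0.
Qed.

Lemma enorm0_eq0 v : enorm v = 0 -> v = 0.
Proof.
move=> v0; apply/rowP => i; rewrite mxE; apply/eqP.
by rewrite -normr_le0 -v0 ler_coord_enorm.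
Qed.

Lemma enorm_le_sum v : enorm v <= \sum_(i < n) `|v 0 i|.
Proof.
have s0 : 0 <= \sum_(i < n) `|v 0 i| by apply: sumr_ge0.
rewrite -(ger0_norm s0) -sqrtr_sqr ler_wsqrtr// expr2 mulr_sumr ler_sum// => i _.
rewrite -(real_normK (num_real (v 0 i))) expr2 ler_wpM2r// (bigD1 i)//= lerDl.
exact: sumr_ge0.
Qed.

(** Cauchy-Schwarz: with [u] and [v] nonzero, summing
    [0 <= (u_i |v| - v_i |u|)^2] over [i] gives [2 <u, v> |u| |v| <= 2 |u|^2 |v|^2],
    and one divides by [2 |u| |v|]. *)
Lemma inner_le_enorm u v : \sum_(i < n) u 0 i * v 0 i <= enorm u * enorm v.
Proof.
have [->|/eqP u0] := eqVneq u 0.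
  by rewrite enorm0 mul0r big1// => i _; rewrite mxE mul0r.
have [->|/eqP v0] := eqVneq v 0.
  by rewrite enorm0 mulr0 big1// => i _; rewrite mxE mulr0.
have up : 0 < enorm u.
  by rewrite lt_neqAle enorm_ge0 andbT eq_sym; apply/eqP => /enorm0_eq0.
have vp : 0 < enorm v.
  by rewrite lt_neqAle enorm_ge0 andbT eq_sym; apply/eqP => /enorm0_eq0.
rewrite -(ler_pM2l (mulr_gt0 up vp)) -(@ler_pM2l _ 2)// !mulr_sumr.
suff -> : 2 * (enorm u * enorm v * (enorm u * enorm v)) =
    \sum_(i < n) (u 0 i ^+ 2 * enorm v ^+ 2 + v 0 i ^+ 2 * enorm u ^+ 2).
  apply: ler_sum => i _; have := sqr_ge0 (u 0 i * enorm v - v 0 i * enorm u).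
  lra.
by rewrite big_split/= -!mulr_suml -!sqr_enorm; ring.
Qed.

Lemma ler_enormD u v : enorm (u + v) <= enorm u + enorm v.
Proof.
have uv0 : 0 <= enorm u + enorm v by rewrite addr_ge0 ?enorm_ge0.
rewrite -(@ler_pXn2r _ 2)// ?nnegrE ?enorm_ge0// sqr_enorm.
have -> : \sum_(i < n) (u + v) 0 i ^+ 2 =
    enorm u ^+ 2 + enorm v ^+ 2 + 2 * \sum_(i < n) u 0 i * v 0 i.
  rewrite !sqr_enorm mulr_sumr -!big_split/=; apply: eq_bigr => i _.
  by rewrite mxE; ring.
by have := inner_le_enorm u v; lra.
Qed.

Lemma continuous_enorm : continuous (@enorm R n).
Proof.
move=> v; apply: continuous_comp; last exact: sqrt_continuous.
apply: (continuous_big add_continuous) => i _ w.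
apply: (@continuous_comp _ _ _ (fun u : 'rV[R]_n => u 0 i) (fun a => a ^+ 2)).
  exact: coord_continuous.
exact: exprn_continuous.
Qed.

Lemma has_lbound_dist x A : has_lbound [set enorm (x - z) | z in A].
Proof. by exists 0 => _ [z _ <-]; exact: enorm_ge0. Qed.

Lemma dist_le x z A : A z -> dist x A <= enorm (x - z).
Proof. by move=> Az; apply: ge_inf; [exact: has_lbound_dist|exists z]. Qed.

Lemma dist_lt_ex x A r : A !=set0 -> dist x A < r ->
  exists2 z, A z & enorm (x - z) < r.
Proof.
move=> [z0 Az0] /inf_lt[|_ [z Az <-]]; last by exists z.
by exists (enorm (x - z0)); exists z0.
Qed.

Lemma dist_lip x y A : A !=set0 -> dist y A <= dist x A + enorm (y - x).
Proof.
move=> [z0 Az0]; rewrite -lerBlDr; apply: lb_le_inf.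
  by exists (enorm (x - z0)); exists z0.
move=> _ [z Az <-]; rewrite lerBlDr.
apply: le_trans (dist_le y Az) _; rewrite -(subrKA x) addrC.
exact: ler_enormD.
Qed.

End EuclideanNorm.

(** * Integration over bounded intervals for the completed Lebesgue measure *)

Section LebesgueInterval.
Context {R : realType}.
Notation mu := (@completed_lebesgue_measure R).
Implicit Types (D : set (lebesgueTypeR R)) (g : R -> R).

(** The Lebesgue sigma-algebra is presented as the Caratheodory one of the
    length outer measure, and Caratheodory measurability of Borel sets is part
    of the extension theorem. *)
Lemma measurable_lebesgue (D : set (measurableTypeR R)) :
  measurable D -> measurable (D : set (lebesgueTypeR R)).
Proof. exact: sub_caratheodory. Qed.

Lemma measurable_lebesgue_itv (i : interval R) :
  measurable ([set` i] : set (lebesgueTypeR R)).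
Proof. by apply: measurable_lebesgue; exact: measurable_itv. Qed.

Lemma lebesgue_itv (b0 b1 : bool) (a b : R) : a <= b ->
  mu [set` Interval (BSide b0 a) (BSide b1 b)] = (b - a)%:E.
Proof.
(* Both measures are restrictions of the same outer measure. *)
rewrite (_ : mu _ = lebesgue_measure [set` Interval (BSide b0 a) (BSide b1 b)])//.
rewrite lebesgue_measure_itv/= lte_fin le_eqVlt => /predU1P[->|->//].
by rewrite ltxx subrr.
Qed.

Lemma bounded_integrable D g (a b K : R) :
  measurable D -> D `<=` `[a, b] ->
  measurable_fun D (g : lebesgueTypeR R -> R) ->
  (forall r, D r -> `|g r| <= K) ->
  mu.-integrable D (EFin \o g).
Proof.
move=> mD Dab mg gK; apply: measurable_bounded_integrable => //.
  have mab := measurable_lebesgue_itv `[a, b].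
  apply: (@le_lt_trans _ _ (mu `[a, b])); first by rewrite le_measure ?inE.
  have [ab|ba] := leP a b; first by rewrite lebesgue_itv// ltry.
  by rewrite set_itv_ge ?measure0// bnd_simp -ltNge.
by exists K; split; [exact: num_real|move=> x Kx r /gK/le_trans; apply; exact: ltW].
Qed.

Lemma normr_Rintegral_le D g (a b K : R) : a <= b -> 0 <= K ->
  measurable D -> D `<=` `[a, b] ->
  measurable_fun D (g : lebesgueTypeR R -> R) ->
  (forall r, D r -> `|g r| <= K) ->
  `|\int[mu]_(r in D) g r| <= K * (b - a).
Proof.
move=> ab K0 mD Dab mg gK.
have ig := bounded_integrable mD Dab mg gK.
have mab := measurable_lebesgue_itv `[a, b].
have muD : (mu D <= (b - a)%:E)%E.
  by rewrite -(lebesgue_itv true false ab) le_measure ?inE.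
apply: le_trans (le_normr_Rintegral mD ig) _.
apply: (@le_trans _ _ (\int[mu]_(r in D) K)).
  apply: le_Rintegral => //.
    exact: integrable_norm.
  apply: (bounded_integrable mD Dab); first exact: measurable_cst.
  by move=> r Dr; rewrite ger0_norm.
rewrite Rintegral_cst// ler_wpM2l// -lee_fin fineK//.
by rewrite ge0_fin_numE// (le_lt_trans muD) ?ltry.
Qed.

Lemma measurable_step (c k a b : R) :
  measurable_fun setT
    ((fun r => c + k * \1_`[a, b] r) : lebesgueTypeR R -> R).
Proof.
apply: measurable_funD; first exact: measurable_cst.
apply: measurable_funM; first exact: measurable_cst.
exact: measurable_indic (measurable_lebesgue_itv _).
Qed.

Lemma integrable_step (c k a b t : R) :
  mu.-integrable `[0, t] (EFin \o (fun r => c + k * \1_`[a, b] r)).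
Proof.
apply: (@bounded_integrable _ _ 0 t (`|c| + `|k|)).
- exact: measurable_lebesgue_itv.
- exact: subset_refl.
- exact/measurable_funTS/measurable_step.
- move=> r _; apply: le_trans (ler_normD _ _) _.
  rewrite lerD2l normrM ler_piMr// indicE ger0_norm//.
  by case: (_ \in _).
Qed.

(** Both cost estimates compare the running cost with a function that jumps
    from [c] to [c + k] on one subinterval; this is the integral of that
    function. *)
Lemma Rintegral_step (c k a b t : R) : 0 <= a -> a <= b -> b <= t ->
  \int[mu]_(r in `[0, t]) (c + k * \1_`[a, b] r) = c * t + k * (b - a).
Proof.
move=> a0 ab bt.
have t0 : 0 <= t by rewrite (le_trans a0)// (le_trans ab).
have m0t := measurable_lebesgue_itv `[0, t].
have mab := measurable_lebesgue_itv `[a, b].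
have i1 : mu.-integrable `[0, t] (EFin \o \1_`[a, b]).
  have := integrable_step 0 1 a b t; congr (mu.-integrable _ _).
  by apply/funext => r/=; rewrite add0r mul1r.
have ic : mu.-integrable `[0, t] (EFin \o cst c).
  have := integrable_step c 0 a b t; congr (mu.-integrable _ _).
  by apply/funext => r/=; rewrite mul0r addr0.
have ik : mu.-integrable `[0, t] (EFin \o (fun r => k * \1_`[a, b] r)).
  have := integrable_step 0 k a b t; congr (mu.-integrable _ _).
  by apply/funext => r/=; rewrite add0r.
rewrite RintegralD// RintegralZl// Rintegral_cst//.
congr (_ * _ + _ * _).
  by rewrite [X in fine X](lebesgue_itv true false t0)/= subr0.
rewrite /Rintegral integral_indic// setIidl.
  by rewrite [X in fine X](lebesgue_itv true false ab).
by move=> r /=; rewrite !in_itv/= => /andP[/(le_trans a0)-> /le_trans->].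
Qed.

End LebesgueInterval.

(** * Borel measurability on the Euclidean space *)

Section EuclideanBorel.
Context {R : realType} {n : nat}.

Lemma continuous_measurable_borelRn (g : 'rV[R]_n -> R) : continuous g ->
  measurable_fun setT (g : borelTypeRn R n -> R).
Proof.
move=> cg; apply: (measurability _ (RGenOpens.measurableE R)).
move=> _ [_ [a [b ->] <-]]; rewrite setTI.
apply: sub_sigma_algebra; move/continuousP: cg; apply.
exact: interval_open.
Qed.

(** This is what makes a control of the form [scalar function times a fixed
    vector] measurable into the Borel sets of the space. *)
Lemma measurable_ray (v : 'rV[R]_n) :
  measurable_fun setT ((fun r => r *: v) : R -> borelTypeRn R n).
Proof.
have := @measurability _ _ R (borelTypeRn R n) setT (fun r => r *: v) (@open 'rV[R]_n).
apply => // _ [U oU <-].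
rewrite setTI; apply: open_measurable.
have /continuousP : continuous (fun r : R => r *: v); last exact.
by move=> r; apply: cvgZr_tmp; exact: cvg_id.
Qed.

End EuclideanBorel.

(** * Admissible controls and their trajectories *)

Section Control.
Context {R : realType} {n : nat}.
Notation mu := (@completed_lebesgue_measure R).
Implicit Types (f : 'rV[R]_n -> R) (x y z : 'rV[R]_n) (alpha : R -> 'rV[R]_n).

Lemma fmin_le f x : bounded_fun f -> fmin f <= f x.
Proof. by move=> bf; apply: ge_inf; [exact: bounded_fun_has_lbound|exists x]. Qed.

Lemma admissible_ge0 (M : R) alpha : admissible M alpha -> 0 <= M.
Proof. by move=> [_ /(_ 0 (lexx _))]; apply: le_trans; exact: enorm_ge0. Qed.

Lemma admissible_comp_measurable (M : R) alpha (g : 'rV[R]_n -> R)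
    (D : set (lebesgueTypeR R)) :
  admissible M alpha -> continuous g -> D `<=` `[0, +oo[ ->
  measurable_fun D ((fun r => g (alpha r)) : lebesgueTypeR R -> R).
Proof.
move=> [malpha _] cg D0.
apply: (measurable_funS (measurable_lebesgue_itv `[0, +oo[) D0).
apply: (measurableT_comp (f := (g : borelTypeRn R n -> R))) => //.
exact: continuous_measurable_borelRn.
Qed.

Lemma admissible_coord_measurable (M : R) alpha i (D : set (lebesgueTypeR R)) :
  admissible M alpha -> D `<=` `[0, +oo[ ->
  measurable_fun D ((fun r => alpha r 0 i) : lebesgueTypeR R -> R).
Proof.
move=> adm; apply: (admissible_comp_measurable (g := fun v => v 0 i) adm).
exact: coord_continuous.
Qed.

Lemma admissible_coord_le (M : R) alpha i (r : R) :
  admissible M alpha -> 0 <= r -> `|alpha r 0 i| <= M.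
Proof.
by move=> [_ aM] /aM; apply: le_trans; exact: ler_coord_enorm.
Qed.

(** The increment is the integral of the control over [[0, s] \ [0, r]],
    which lies in [[r, s]]. Writing the difference of intervals instead of
    [[r, s]] also covers negative [r] and [s], for which [[0, r]] is empty and
    the trajectory has not left [x]; hence trajectories are Lipschitz on the
    whole line. *)
Lemma trajectory_coord_lip (M : R) x alpha (r s : R) i :
  admissible M alpha -> r <= s ->
  `|trajectory x alpha s 0 i - trajectory x alpha r 0 i| <= M * (s - r).
Proof.
move=> adm rs; have M0 := admissible_ge0 adm.
have ms := measurable_lebesgue_itv `[0, s].
have mr := measurable_lebesgue_itv `[0, r].
have sub0 t : `[0, t] `<=` (`[0, +oo[ : set R).
  by move=> u /=; rewrite !in_itv/= andbT => /andP[].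
have icoord : mu.-integrable `[0, s] (EFin \o (fun u => alpha u 0 i)).
  apply: (@bounded_integrable _ _ _ 0 s M).
  - exact: measurable_lebesgue_itv.
  - exact: subset_refl.
  - by apply: (admissible_coord_measurable _ adm); exact: sub0.
  - by move=> u /=; rewrite in_itv/= => /andP[/(admissible_coord_le i adm)].
have rs_sub : `[0, r] `<=` (`[0, s] : set R).
  by move=> u /=; rewrite !in_itv/= => /andP[-> /le_trans->].
have sub_s : `[0, s] `\` `[0, r] `<=` (`[0, s] : set R) by exact: subDsetl.
rewrite !mxE opprD addrACA subrr add0r -{1}(setDUK rs_sub) Rintegral_setU//; last 3 first.
- exact: measurableD.
- by rewrite setDUK.
- by apply/disj_setPS => u [? []].
rewrite addrC addKr; apply: normr_Rintegral_le.
- exact: rs.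
- exact: M0.
- exact: measurableD.
- move=> u [/=]; rewrite !in_itv/= => /andP[u0 us].
  by rewrite u0/= us andbT => /negP; rewrite -ltNge => /ltW.
- by apply: (admissible_coord_measurable _ adm) => u /sub_s/sub0.
- move=> u /sub_s/=; rewrite in_itv/= => /andP[+ _].
  exact: admissible_coord_le.
Qed.

(** The factor [n] comes from bounding the Euclidean norm by the sum of the
    coordinates. The constant [M] is sharper, but any Lipschitz constant common to all
    admissible trajectories serves the excursion argument. *)
Lemma trajectory_lip (M : R) x alpha (r s : R) :
  admissible M alpha -> r <= s ->
  enorm (trajectory x alpha s - trajectory x alpha r) <= n%:R * M * (s - r).
Proof.
move=> adm rs; apply: le_trans (enorm_le_sum _) _.
apply: (@le_trans _ _ (\sum_(i < n) M * (s - r))).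
  apply: ler_sum => i _.
  have := trajectory_coord_lip x i adm rs.
  by rewrite !mxE.
by rewrite sumr_const card_ord -[leLHS]mulr_natl mulrA.
Qed.

Lemma trajectory0 (M : R) x alpha : admissible M alpha ->
  trajectory x alpha 0 = x.
Proof.
move=> adm; apply/rowP => i; rewrite mxE -[RHS]addr0; congr (_ + _).
apply/eqP; rewrite -normr_le0.
apply: (@le_trans _ _ (M * (0 - 0))); last by rewrite subrr mulr0.
apply: normr_Rintegral_le.
- exact: lexx.
- exact: admissible_ge0 adm.
- exact: measurable_lebesgue_itv.
- exact: subset_refl.
- apply: (admissible_coord_measurable _ adm) => u /=.
  by rewrite !in_itv/= andbT => /andP[].
- by move=> u /=; rewrite in_itv/= => /andP[/(admissible_coord_le i adm)].
Qed.

(** Convergence of row vectors is tested in the sup norm, for which the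
    coordinatewise Lipschitz bound suffices. The radius is divided by [M + 1],
    which is positive even if [M = 0]. *)
Lemma continuous_trajectory (M : R) x alpha :
  admissible M alpha -> continuous (trajectory x alpha).
Proof.
move=> adm s; have M0 := admissible_ge0 adm.
have L0 : 0 < M + 1 by rewrite ltr_pwDr.
apply/cvgrPdist_le => /= e e0.
have coordL r i : `|s - r| <= e / (M + 1) ->
    `|trajectory x alpha s 0 i - trajectory x alpha r 0 i| <= e.
  rewrite ler_pdivlMr// => sr.
  have Me : M * `|s - r| <= e.
    by apply: le_trans sr; rewrite mulrC ler_wpM2l// lerDl.
  apply: le_trans Me; have [rs|/ltW sr'] := leP r s.
    by rewrite [`|s - r|]ger0_norm ?subr_ge0//; exact: trajectory_coord_lip.
  rewrite distrC [`|s - r|]distrC [`|r - s|]ger0_norm ?subr_ge0//.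
  exact: trajectory_coord_lip.
near=> r.
rewrite /Num.norm/= mx_normrE; apply: bigmax_le => [|[j i] _]; first exact: ltW.
rewrite /= ord1; have := @coordL r i; rewrite !mxE; apply.
near: r; apply: cvgr_dist_le; first exact: cvg_id.
by rewrite divr_gt0.
Unshelve. all: by end_near. Qed.

(** * Bounds on the cost and the value *)

(** The kinetic term is measurable because the control is, and the potential
    term because [f] along the trajectory is continuous; both are bounded. *)
Lemma cost_integrable (M t : R) f x alpha :
  continuous f -> bounded_fun f -> admissible M alpha ->
  mu.-integrable `[0, t]
    (EFin \o (fun s => 2^-1 * enorm (alpha s) ^+ 2 + f (trajectory x alpha s))).
Proof.
move=> cf bf adm; have M0 := admissible_ge0 adm.
have [lb lbP] := bounded_fun_has_lbound bf.
have [ub ubP] := bounded_fun_has_ubound bf.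
have sub0 : `[0, t] `<=` (`[0, +oo[ : set R).
  by move=> u /=; rewrite !in_itv/= andbT => /andP[].
apply: (@bounded_integrable _ _ _ 0 t (2^-1 * M ^+ 2 + (`|lb| + `|ub|))).
- exact: measurable_lebesgue_itv.
- exact: subset_refl.
- apply: measurable_funD.
    apply: measurable_funM; first exact: measurable_cst.
    apply: measurable_funX; apply: (admissible_comp_measurable adm) => //.
    exact: continuous_enorm.
  apply: measurable_funTS => _ B mB; rewrite setTI; apply: measurable_lebesgue.
  rewrite -[X in measurable X]setTI.
  apply: (@continuous_measurable_fun _ (f \o trajectory x alpha)) => //.
  move=> s; apply: continuous_comp; last exact: cf.
  exact: continuous_trajectory adm _.
- move=> s /=; rewrite in_itv/= => /andP[s0 _].
  apply: le_trans (ler_normD _ _) _; apply: lerD.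
    rewrite ger0_norm; last by apply: mulr_ge0 => //; exact: sqr_ge0.
    rewrite ler_wpM2l//.
    by rewrite ler_pXn2r ?nnegrE ?enorm_ge0// adm.2.
  have := lbP _ (ex_intro2 _ _ (trajectory x alpha s) I erefl).
  have := ubP _ (ex_intro2 _ _ (trajectory x alpha s) I erefl).
  move=> h1 h2; rewrite ler_norml; apply/andP; split.
    have := ler_norm (- lb); rewrite normrN; have := normr_ge0 ub; lra.
  have := ler_norm ub; have := normr_ge0 lb; lra.
Qed.

(** Dropping the kinetic term, a trajectory pays at least [c] at all times
    and [k] more while it stays where [f] exceeds [c] by [k]. *)
Lemma cost_ge (M t c k a b : R) f x alpha :
  continuous f -> bounded_fun f -> admissible M alpha ->
  0 <= a -> a <= b -> b <= t ->
  (forall y, c <= f y) ->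
  (forall r, a <= r -> r <= b -> c + k <= f (trajectory x alpha r)) ->
  c * t + k * (b - a) <= cost f t x alpha.
Proof.
move=> cf bf adm a0 ab bt cle ckle; rewrite -(Rintegral_step c k a0 ab bt).
have pointwise (r : R) : c + k * \1_`[a, b] r <=
    2^-1 * enorm (alpha r) ^+ 2 + f (trajectory x alpha r).
  apply: (@le_trans _ _ (f (trajectory x alpha r))).
    rewrite indicE mem_setE in_itv/=.
    by case: andP => [[ar rb]|_]; [rewrite mulr1 ckle|rewrite mulr0 addr0].
  by rewrite lerDr; apply: mulr_ge0 => //; exact: sqr_ge0.
apply: le_Rintegral => //.
- exact: measurable_lebesgue_itv.
- exact: integrable_step.
- exact: cost_integrable adm.
Qed.

(** When [t < d] the jump interval is cut at [t], whence the minimum below. *)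
Lemma cost_le (M t c k d : R) f x alpha :
  continuous f -> bounded_fun f -> admissible M alpha ->
  0 <= t -> 0 <= d -> 0 <= k ->
  (forall r, 0 <= r -> r <= d ->
     2^-1 * enorm (alpha r) ^+ 2 + f (trajectory x alpha r) <= c + k) ->
  (forall r, d < r ->
     2^-1 * enorm (alpha r) ^+ 2 + f (trajectory x alpha r) <= c) ->
  cost f t x alpha <= c * t + k * d.
Proof.
move=> cf bf adm t0 d0 k0 before after.
have m0 : 0 <= Num.min d t by rewrite le_min d0.
have mt : Num.min d t <= t by rewrite ge_min lexx orbT.
apply: (@le_trans _ _ (c * t + k * (Num.min d t - 0))); last first.
  by rewrite subr0 lerD2l ler_wpM2l// ge_min lexx.
rewrite -(Rintegral_step c k (lexx 0) m0 mt).
apply: le_Rintegral => //.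
- exact: measurable_lebesgue_itv.
- exact: cost_integrable adm.
- exact: integrable_step.
move=> r /=; rewrite in_itv/= => /andP[r0 rt].
rewrite indicE mem_setE in_itv/= r0/= le_min rt andbT.
by have [rd|dr] := leP r d; rewrite ?mulr1 ?mulr0 ?addr0; [exact: before|exact: after].
Qed.

(** The infimum defining the value is over a set bounded below by
    [fmin f * t], since the kinetic term is nonnegative. *)
Lemma value_le (M t : R) f x alpha :
  continuous f -> bounded_fun f -> 0 <= t -> admissible M alpha ->
  value f M t x <= cost f t x alpha.
Proof.
move=> cf bf t0 adm; apply: ge_inf; last by exists alpha.
exists (fmin f * t) => _ [beta admb <-].
apply: le_trans (cost_ge (k := 0) cf bf admb (lexx 0) (lexx 0) t0 _ _).
- by rewrite mul0r addr0.
- by move=> y; exact: fmin_le.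
- by move=> r _ _; rewrite addr0; exact: fmin_le.
Qed.

(** Move from [x] to [z] in a straight line at unit speed, then stop. If
    [z = x] the direction is [0^-1 *: 0 = 0], so the control vanishes. *)
Definition steer x z (r : R) : 'rV[R]_n :=
  \1_`[0, enorm (z - x)] r *: ((enorm (z - x))^-1 *: (z - x)).

Lemma enorm_steer x z r : enorm (steer x z r) <= 1.
Proof.
rewrite /steer !enormZ ger0_norm ?indicE ?ler0n// [`|_^-1|]ger0_norm; last first.
  by rewrite invr_ge0 enorm_ge0.
have [->|d0] := eqVneq (enorm (z - x)) 0; first by rewrite !mulr0 ler01.
by rewrite mulVf// mulr1 lern1; case: (_ \in _).
Qed.

Lemma admissible_steer (M : R) x z : 1 <= M -> admissible M (steer x z).
Proof.
move=> M1; split=> [|s _]; last exact: le_trans (enorm_steer _ _ _) M1.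
apply: measurable_funTS.
apply: (measurableT_comp (measurable_ray ((enorm (z - x))^-1 *: (z - x)))).
exact: measurable_indic (measurable_lebesgue_itv _).
Qed.

Lemma trajectory_steer x z s : enorm (z - x) <= s ->
  trajectory x (steer x z) s = z.
Proof.
move=> ds; apply/rowP => i; rewrite mxE.
have := Rintegral_step 0 ((enorm (z - x))^-1 * (z - x) 0 i) (lexx 0)
  (enorm_ge0 (z - x)) ds.
rewrite mul0r add0r subr0 => step.
transitivity (x 0 i + (enorm (z - x))^-1 * (z - x) 0 i * enorm (z - x)).
  rewrite -step; congr (_ + _); apply: eq_Rintegral => r _.
  by rewrite 2!mxE add0r mulrC.
have [d0|d0] := eqVneq (enorm (z - x)) 0.
  by rewrite d0 mulr0 addr0; move/enorm0_eq0/subr0_eq : d0 => ->.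
by rewrite mulrAC mulVf// mul1r !mxE addrCA subrr addr0.
Qed.

(** Being at distance [d] from a minimizer costs at most a multiple of [d]
    above the minimum: the control [steer] spends time [d] travelling, with
    excess running cost at most [1/2 + K], and nothing afterwards. This bound
    uses only the oscillation [K] of [f], and no modulus of continuity, so that
    it is uniform although the set of minimizers need not be compact. *)
Lemma value_le_minimizer (M t K : R) f x z :
  continuous f -> bounded_fun f -> 0 <= t -> 1 <= M ->
  (forall y, f y <= fmin f + K) -> minimizers f z ->
  value f M t x <= fmin f * t + (2^-1 + K) * enorm (x - z).
Proof.
move=> cf bf t0 M1 fK zmin.
have adm := admissible_steer x z M1.
have K0 : 0 <= K by have := fK z; rewrite zmin lerDl.
apply: le_trans (value_le x cf bf t0 adm) _; rewrite enormBC.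
apply: (cost_le cf bf adm) => //.
- exact: enorm_ge0.
- by rewrite addr_ge0.
- move=> r _ _; rewrite addrCA lerD//.
  by rewrite ler_piMr// expr_le1 ?enorm_ge0 ?enorm_steer.
- move=> r dr; rewrite (trajectory_steer (ltW dr)) zmin.
  rewrite /steer indicE mem_setE in_itv/= [(r <= _)]leNgt dr/= andbF scale0r.
  by rewrite enorm0 expr0n/= mulr0 add0r.
Qed.

Lemma well_separatedP f (delta : R) : well_separated f -> 0 < delta ->
  exists2 gamma : R, 0 < gamma &
    forall y, delta < dist y (minimizers f) -> fmin f + gamma <= f y.
Proof.
move=> sep /sep[gamma gamma0 gammaP]; exists gamma => // y ydelta.
rewrite -lerBrDl -lee_fin; apply: le_trans (ltW gammaP) _.
by apply: ereal_inf_lbound; exists y.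
Qed.

(** * Lyapunov stability *)

(** An excursion beyond [delta] is too expensive. If a trajectory that starts
    within [eta] is farther than [delta] at time [s], then, being [L]-Lipschitz,
    it stays farther than [delta / 2] during the time interval [[s - h, s]] with
    [h = delta / (2 L)], and so pays at least [gamma * h] above [fmin f * t].
    Near-optimality allows at most [2 (1/2 + K) eta + eps], which the choice of
    [eta] and [eps0] keeps below [gamma * h]. *)
Lemma eps_optimal_stable (M t delta : R) f :
  continuous f -> bounded_fun f -> minimizers f !=set0 -> well_separated f ->
  1 <= M -> 0 <= t -> 0 < delta ->
  exists2 eta : R, 0 < eta & exists2 eps0 : R, 0 < eps0 &
    forall eps x alpha, eps <= eps0 -> eps_optimal f M t eps x alpha ->
      dist x (minimizers f) <= eta ->
      forall s : R, 0 <= s -> s <= t ->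
        dist (trajectory x alpha s) (minimizers f) <= delta.
Proof.
move=> cf bf min0 sep M1 t0 delta0.
have delta2 : 0 < delta / 2 by rewrite divr_gt0.
have [gamma gamma0 gammaP] := well_separatedP sep delta2.
have [ub ubP] := bounded_fun_has_ubound bf.
pose K := ub - fmin f.
have fK y : f y <= fmin f + K.
  by rewrite /K addrC subrK; apply: ubP; exists y.
have K0 : 0 <= K by case: min0 => z zmin; have := fK z; rewrite zmin lerDl.
pose C := 2^-1 + K; have C0 : 0 < C by rewrite ltr_wpDr.
(* Adding 1 keeps L positive in dimension 0. *)
pose L := n%:R * M + 1.
have nM0 : 0 <= n%:R * M by rewrite mulr_ge0// (le_trans ler01).
have L0 : 0 < L by rewrite ltr_wpDl.
pose h := delta / 2 / L; have h0 : 0 < h by rewrite divr_gt0.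
have Lh : L * h = delta / 2 by rewrite mulrC divfK// gt_eqF.
have gh0 : 0 < gamma * h by rewrite mulr_gt0.
pose eta := Num.min (delta / 2) (gamma * h / (4 * C)).
have eta0 : 0 < eta by rewrite lt_min delta2 divr_gt0// mulr_gt0.
exists eta => //; exists (gamma * h / 2); first by rewrite divr_gt0.
move=> eps x alpha epsle [adm opt] xeta s s0 st.
rewrite leNgt; apply/negP => far.
have lip r u : r <= u ->
    enorm (trajectory x alpha u - trajectory x alpha r) <= L * (u - r).
  move=> ru; apply: le_trans (trajectory_lip x adm ru) _.
  by rewrite ler_wpM2r ?subr_ge0// lerDl.
(* Reaching distance delta from distance delta / 2 already takes time h. *)
have hs : h <= s.
  rewrite -(ler_pM2l L0) Lh -(lerD2l (delta / 2)) -splitr.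
  apply: le_trans (ltW far) _; apply: le_trans (dist_lip x _ min0) _.
  apply: lerD; first by apply: le_trans xeta _; rewrite ge_min lexx.
  by have := lip 0 s s0; rewrite (trajectory0 x adm) subr0.
have cost_lower : fmin f * t + gamma * h <= cost f t x alpha.
  have sh0 : 0 <= s - h by rewrite subr_ge0.
  have shs : s - h <= s by rewrite gerBl ltW.
  rewrite -[X in gamma * X](subKr s).
  apply: (cost_ge cf bf adm) => //; first by move=> y; exact: fmin_le.
  - move=> r shr rs; apply: gammaP.
    rewrite -(ltrD2r (delta / 2)) -splitr; apply: lt_le_trans far _.
    apply: le_trans (dist_lip (trajectory x alpha r) _ min0) _.
    rewrite lerD2l; apply: le_trans (lip r s rs) _.
    by rewrite -Lh ler_pM2l// lerBlDr addrC -lerBlDr.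
(* An infimum only yields minimizers closer than a strictly larger bound, and
   [2 * eta] is one. *)
have [z zmin xz] : exists2 z, minimizers f z & enorm (x - z) < 2 * eta.
  by apply: dist_lt_ex => //; apply: le_lt_trans xeta _; rewrite ltr_pMl// ltr1n.
have vle := value_le_minimizer x cf bf t0 M1 fK zmin.
have Cxz : C * enorm (x - z) < C * (2 * eta) by rewrite ltr_pM2l.
have Ceta : C * (2 * eta) <= gamma * h / 2.
  have : eta <= gamma * h / (4 * C) by rewrite ge_min lexx orbT.
  rewrite ler_pdivlMr ?mulr_gt0//; lra.
move: cost_lower; apply/negP; rewrite -ltNge; apply: le_lt_trans opt _.
rewrite [gamma * h]splitr addrA ltr_leD//; apply: le_lt_trans vle _.
by rewrite ltrD2l; exact: lt_le_trans Cxz Ceta.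
Qed.

End Control.

Theorem theorem4p6 (R : realType) (n : nat) (f : 'rV[R]_n -> R) (M t : R)
    (f_continuous : continuous f)
    (f_bounded : bounded_fun f)
    (minimizers_nonempty : minimizers f !=set0)
    (f_well_separated : well_separated f)
    (M_large : 1 + Num.sqrt (6 * supnorm f) <= M)
    (t_ge0 : 0 <= t) :
  (forall delta : R, 0 < delta ->
     exists2 eta : R, 0 < eta &
     exists2 eps0 : R, 0 < eps0 &
     forall eps : R, 0 < eps -> eps <= eps0 ->
     forall (x : 'rV[R]_n) (alpha : R -> 'rV[R]_n),
       eps_optimal f M t eps x alpha ->
       dist x (minimizers f) <= eta ->
       forall s : R, 0 <= s -> s <= t ->
         dist (trajectory x alpha s) (minimizers f) <= delta) /\
  (forall delta : R, 0 < delta ->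
     exists2 eta : R, 0 < eta &
     forall (x : 'rV[R]_n) (alpha : R -> 'rV[R]_n),
       optimal f M t x alpha ->
       dist x (minimizers f) <= eta ->
       forall s : R, 0 <= s -> s <= t ->
         dist (trajectory x alpha s) (minimizers f) <= delta).
Proof.
have M1 : 1 <= M by apply: le_trans M_large; rewrite lerDl sqrtr_ge0.
split=> delta /(eps_optimal_stable f_continuous f_bounded minimizers_nonempty
    f_well_separated M1 t_ge0)[eta eta0 [eps0 eps00 stable]].
  exists eta => //; exists eps0 => // eps _ epsle x alpha.
  exact: stable.
by exists eta => // x alpha; exact: stable (ltW eps00).
Qed.
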